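(* Let $M\ge1$ be the desired committee size and let the weight vector $\vec w=(w_1,\dots,w_N)$, with positive entries summing to $1$, satisfy $\max_{n\in[N]}w_n<1/M$. Then the sortition algorithm Stitch with input $(\vec w,M)$ is $\lambda$-decentralized with $\lambda=M\min_{i\in[N]}w_i$.
   Context: Setting: there are $N$ participants, indexed by $[N]=\{1,\dots,N\}$, with positive weights $w_i$, $\sum_i w_i=1$. A sortition algorithm outputs a random committee $\mathcal{M}\subseteq[N]$ and unnormalized weights $g_n$; the voting power is $g(n;\mathcal{M})=g_n/\sum_{m\in\mathcal{M}}g_m$ for $n\in\mathcal{M}$ and $g(n;\mathcal{M})=0$ for $n\notin\mathcal{M}$. For $\lambda>0$, the algorithm is $\lambda$-decentralized if for every committee realization $\mathcal{M}$ (every committee that can be output), $\max_{m\in\mathcal{M}}\frac{g(m;\mathcal{M})}{w_m}\le\frac1\lambda$. Algorithm Stitch (input $\vec w$, $M$): (1, optional) apply a random permutation of the set of participants to $\vec w$; (2) divide the unit interval into consecutive subintervals, the one of participant $i$ having length $w_i$ (subintervals are taken half-open, $[w_1+\dots+w_{i-1},\,w_1+\dots+w_i)$, in the chosen order); (3) sample $x$ uniformly from $[0,1]$; (4) let $\mathcal{M}$ be the set of all participants whose subinterval contains at least one of the points $\{x+i/M\}$, $i\in[M]=\{1,\dots,M\}$, where $\{\cdot\}$ denotes the fractional part; (5) set $g_i=1$ for $i\in\mathcal{M}$ and $g_i=0$ for $i\notin\mathcal{M}$. *)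

(* Defs.v *)
From HB Require Import structures.
From mathcomp Require Import all_boot all_order all_algebra all_fingroup.
From mathcomp Require Import all_classical all_reals all_analysis.

Set Implicit Arguments.
Unset Strict Implicit.
Unset Printing Implicit Defensive.

Import Order.TTheory GRing.Theory Num.Theory.
Local Open Scope ring_scope.

(* Participants are indexed from 0, by 'I_N. Both outputs are functions of the
   outcome omega : Omega of the randomness used by the algorithm. *)
Record sortition (R : realType) (N : nat) (Omega : Type) := Sortition {
  committee : Omega -> {set 'I_N};
  raw_weight : Omega -> 'I_N -> R }.

Definition voting_power (R : realType) (N : nat) (Omega : Type)
    (S : sortition R N Omega) (omega : Omega) (n : 'I_N) : R :=
  if n \in committee S omega then
    raw_weight S omega n / \sum_(m in committee S omega) raw_weight S omega m
  else 0.

(* The default 0 of the maximum is immaterial: the bound 1 / lambda is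
   positive. Every outcome counts, including those of probability zero. *)
Definition decentralized (R : realType) (N : nat) (Omega : Type)
    (w : 'I_N -> R) (S : sortition R N Omega) (lambda : R) : Prop :=
  0 < lambda /\
  forall omega : Omega,
    \big[Num.max/0]_(m in committee S omega) (voting_power S omega m / w m)
      <= 1 / lambda.

Definition frac_part (R : realType) (x : R) : R := x - (Num.floor x)%:~R.

(* s j is the rank of participant j in the order in which the subintervals
   are laid out. *)
Definition stitch_left (R : realType) (N : nat) (w : 'I_N -> R) (s : 'S_N)
    (n : 'I_N) : R :=
  \sum_(j < N | (s j < s n)%N) w j.

Definition stitch_interval (R : realType) (N : nat) (w : 'I_N -> R) (s : 'S_N)
    (n : 'I_N) : interval R :=
  `[stitch_left w s n, stitch_left w s n + w n[.

Definition stitch_committee (R : realType) (N : nat) (w : 'I_N -> R) (M : nat)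
    (s : 'S_N) (x : R) : {set 'I_N} :=
  [set n | [exists i : 'I_M,
     frac_part (x + i.+1%:R / M%:R) \in stitch_interval w s n]].

(* perm is the random order (constantly 1%g when the shuffling step is
   skipped), X the random point. *)
Definition stitch (R : realType) (N : nat) (Omega : Type) (w : 'I_N -> R)
    (M : nat) (perm : Omega -> 'S_N) (X : Omega -> R) : sortition R N Omega :=
  {| committee := fun omega => stitch_committee w M (perm omega) (X omega);
     raw_weight := fun omega n =>
       (n \in stitch_committee w M (perm omega) (X omega))%:R |}.

Definition random_perm (d : measure_display) (Omega : measurableType d)
    (N : nat) (perm : Omega -> 'S_N) : Prop :=
  forall s : 'S_N, measurable [set omega | perm omega = s]%classic.

Definition uniform_sample01 (R : realType) (d : measure_display)
    (Omega : measurableType d) (P : probability Omega R)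
    (X : {RV P >-> R}) : Prop :=
  (forall omega, X omega \in `[0, 1]) /\
  (forall A : set R, measurable A ->
     distribution P X A = uniform_prob (@ltr01 R) A).

(* Main.v *)
(* The points [x + i/M] are at circular distance at least [1/M] from one
   another, so each subinterval contains at most one of them and the committee
   has at least [M] members, all of equal voting power. *)

Require Import Defs.
From HB Require Import structures.
From mathcomp Require Import all_boot all_order all_algebra all_fingroup.
From mathcomp Require Import all_classical all_reals all_analysis.
From mathcomp Require Import ring lra zify.

Import Order.TTheory GRing.Theory Num.Theory.
Local Open Scope ring_scope.

Lemma frac_part_itv (R : realType) (x : R) : frac_part x \in `[0, 1[.
Proof.
rewrite in_itv /= /frac_part subr_ge0 ltrBlDl floor_le.
have := floorD1_gt x; rewrite intrD; lra.
Qed.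

Section Covering.
Variables (R : realType) (N : nat) (w : 'I_N -> R) (s : 'S_N).

(** Gives the right endpoint the same prefix-sum form as [stitch_left], so that intervals of
    consecutive ranks abut. Injectivity of [s] makes [n] the only term added. *)
Lemma stitch_rightE (n : 'I_N) :
  stitch_left w s n + w n = \sum_(j < N | (s j < (s n).+1)%N) w j.
Proof.
rewrite [RHS](bigD1 n) //= addrC; congr (_ + _); apply: eq_bigl => j.
by rewrite ltnS [RHS]andbC ltn_neqAle (inj_eq val_inj) (inj_eq perm_inj).
Qed.

Lemma stitch_interval_cover (y : R) :
  \sum_(i < N) w i = 1 -> y \in `[0, 1[ ->
  exists n, y \in stitch_interval w s n.
Proof.
rewrite in_itv /= => w1 /andP[y0 y1].
pose F k := \sum_(j < N | (s j < k)%N) w j.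
have yFN : y < F N by rewrite /F (eq_bigl predT) ?w1 // => j; rewrite ltn_ord.
(* The interval containing [y] belongs to the participant whose rank precedes the least [k] with
   [y < F k]; this [k] is nonzero because [F 0 = 0 <= y]. *)
case: (ex_minnP (ex_intro (fun k => y < F k) N yFN)) => -[|k] yFk kmin.
  by move: yFk; rewrite /F big_pred0 // ltNge y0.
have kN : (k < N)%N := kmin _ yFN.
have sk : s ((s^-1)%g (Ordinal kN)) = Ordinal kN by rewrite permKV.
exists ((s^-1)%g (Ordinal kN)).
rewrite in_itv /= stitch_rightE /stitch_left sk yFk andbT leNgt.
by apply/negP => /kmin; rewrite ltnn.
Qed.

End Covering.

(** Two such points differ by an integer multiple of [1 / M], and by less than [1 / M] when they
    share the interval, so they coincide. Then [M] divides [i - j], whose absolute value is below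
    [M]. *)
Lemma frac_part_shift_inj (R : realType) (M : nat) (x a l : R) (i j : 'I_M) :
  l < 1 / M%:R ->
  frac_part (x + i.+1%:R / M%:R) \in `[a, a + l[ ->
  frac_part (x + j.+1%:R / M%:R) \in `[a, a + l[ ->
  i = j.
Proof.
have M0 : (0 < M%:R :> R) by rewrite ltr0n (leq_ltn_trans _ (ltn_ord i)).
rewrite !in_itv /= /frac_part.
set p := Num.floor _; set q := Num.floor _ => lM /andP[ai il] /andP[aj jl].
(* [z] is [M] times the difference of the two fractional parts: [x] cancels, and only the integer
   parts [p] and [q] remain besides [i - j]. *)
pose z : int := (i%:Z - j%:Z) - (p - q) * M%:Z.
have zE : z%:~R / M%:R = (x + i.+1%:R / M%:R - p%:~R) -
    (x + j.+1%:R / M%:R - q%:~R) :> R.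
  rewrite /z !(intrD, rmorphN, rmorphM, rmorphB) /= -!pmulrn -!natr1.
  by field; rewrite gt_eqF.
have zM : `|z%:~R / M%:R : R| < 1 / M%:R by rewrite zE ltr_norml; lra.
move: zM; rewrite normrM normfV (gtr0_norm M0) ltr_pM2r ?invr_gt0 //.
rewrite -intr_norm ltrz1 => z1.
have z0 : z = 0 by lia.
have iM := ltn_ord i; have jM := ltn_ord j.
apply/val_inj => /=; move: z0; rewrite /z; move: (p - q) => k z0.
have [k1|k1|k0] := ltrgtP k 0; [nia|nia|lia].
Qed.

Lemma card_stitch_committee (R : realType) (N M : nat) (w : 'I_N -> R)
    (s : 'S_N) (x : R) :
  \sum_(i < N) w i = 1 -> (forall n, w n < 1 / M%:R) ->
  (M <= #|stitch_committee w M s x|)%N.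
Proof.
move=> w1 wM.
have cov (i : 'I_M) : exists n,
    frac_part (x + i.+1%:R / M%:R) \in stitch_interval w s n.
  exact: stitch_interval_cover w1 (frac_part_itv _ _).
(* Choosing an owner for each of the [M] points embeds ['I_M] into the committee. *)
pose f (i : 'I_M) := xchoose (cov i).
have f_inj : injective f.
  move=> i j fij; have := xchooseP (cov j); have := xchooseP (cov i).
  by rewrite -/(f i) -/(f j) fij; apply: frac_part_shift_inj (wM (f j)).
rewrite -[X in (X <= _)%N]card_ord -(card_imset _ f_inj).
apply/subset_leq_card/fintype.subsetP => _ /imsetP[i _ ->].
by rewrite inE; apply/existsP; exists i; apply: (xchooseP (cov i)).
Qed.

Theorem proposition4p2 (R : realType) (N M : nat) (w : 'I_N -> R)
    (d : measure_display) (Omega : measurableType d) (P : probability Omega R)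
    (perm : Omega -> 'S_N) (X : {RV P >-> R}) :
  (1 <= M)%N ->
  (forall i, 0 < w i) ->
  \sum_(i < N) w i = 1 ->
  \big[Num.max/0]_(n < N) w n < 1 / M%:R ->
  random_perm perm ->
  uniform_sample01 X ->
  decentralized w (stitch w M perm X)
    (M%:R * \big[Num.min/1]_(i < N) w i).
Proof.
move=> M1 w0 w1 wmax _ _.
have M0 : 0 < M%:R :> R by rewrite ltr0n.
have wM n : w n < 1 / M%:R by apply: le_lt_trans wmax; apply: le_bigmax_cond.
set m := \big[_/_]_(_ < _) _.
(* The default 1 of the minimum is positive, and it exceeds no true minimum since every weight is
   below [1 / M <= 1]. *)
have m0 : 0 < m by apply: lt_bigmin.
split=> [|omega]; first exact: mulr_gt0.
apply: bigmax_le => [|n nC]; first by rewrite divr_ge0 // mulr_ge0 // ltW.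
rewrite /voting_power nC /=; rewrite /= in nC.
set C := stitch_committee _ _ _ _ in nC *.
rewrite nC (eq_bigr (fun=> 1)) => [|i /= ->] //; rewrite sumr_const.
have MC : M%:R <= #|C|%:R :> R by rewrite ler_nat card_stitch_committee.
have C0 : 0 < #|C|%:R :> R := lt_le_trans M0 MC.
(* The voting power is now [1 / #|C|]; inverting leaves [M * m <= #|C| * w n], which holds factor by
   factor. *)
rewrite !div1r -invfM lef_pV2 ?posrE ?mulr_gt0 //.
by apply: ler_pM => //; [exact: ltW | exact: bigmin_le_cond].
Qed.
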